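(* Let $\mathbb{T}$ be a time scale and let $f,g:\mathbb{T}\to\mathbb{C}$ be $\Delta$-differentiable functions with $f(t)\neq 0$ and $g(t)\neq 0$ for all $t\in\mathbb{T}$. Then, for every fixed $\tau\in\mathbb{T}^{\kappa}$, $$\zeta_{\mu(\tau)}\left(\left(\frac{f^{\Delta}}{f}\oplus\frac{g^{\Delta}}{g}\right)(\tau)\right)=\zeta_{\mu(\tau)}\left(\frac{f^{\Delta}(\tau)}{f(\tau)}\right)+\zeta_{\mu(\tau)}\left(\frac{g^{\Delta}(\tau)}{g(\tau)}\right),$$ where $\zeta$ is the multi-valued cylinder transformation.
   Context: A time scale $\mathbb{T}$ is a nonempty closed subset of $\mathbb{R}$, with forward jump operator $\sigma$, graininess $\mu(t)=\sigma(t)-t$, delta derivative $f^{\Delta}$, and $f^{\sigma}=f\circ\sigma$. $\mathbb{T}^{\kappa}$ is $\mathbb{T}$ with its left-scattered maximum removed, if it has one. For functions $a,b$ on $\mathbb{T}^\kappa$, $(a\oplus b)(\tau)=a(\tau)+b(\tau)+\mu(\tau)a(\tau)b(\tau)$. Multi-valued cylinder transformation: for $h\ge 0$ and $z\in\mathbb{C}$ (with $z\neq -1/h$ if $h>0$), $$\zeta_h(z)=\begin{cases}\frac1h\log(1+zh), & h\neq 0,\\ z, & h=0,\end{cases}$$ where $\log$ is the multi-valued complex logarithm, $\log w=\{\lambda\in\mathbb{C}: e^{\lambda}=w\}$ for $w\ne 0$. For $h>0$, $\zeta_h(z)$ is thus a set of complex numbers; for $h=0$ it is the single value $z$ (identified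 with $\{z\}$). Equality of multi-valued expressions is equality of sets of values, and the sum of two multi-valued quantities is the set of all sums of a value of the first and a value of the second. *)

(* Defs.v *)
From Stdlib Require Import Reals.
From Coquelicot Require Import Coquelicot.

Open Scope R_scope.

(** * Time scales

    A subset of [R] is a predicate [R -> Prop].  A function on a time scale [T]
    is a total function on [R] of which only the values on [T] are ever used. *)

Definition time_scale (T : R -> Prop) : Prop :=
  (exists t, T t) /\ closed T.

(** inf {s in T | t < s}, with the usual convention inf {} = sup T.
    (For [t] in [T] the set is bounded below by [t], so the second branch is
    reached only when it is empty, that is, when [t] is the maximum of [T].) *)
Definition sigma (T : R -> Prop) (t : R) : R :=
  match Glb_Rbar (fun s => T s /\ t < s) with
  | Finite s => s
  | _ => real (Lub_Rbar T)
  end.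

(** sup {s in T | s < t}, with the usual convention sup {} = inf T. *)
Definition rho (T : R -> Prop) (t : R) : R :=
  match Lub_Rbar (fun s => T s /\ s < t) with
  | Finite s => s
  | _ => real (Glb_Rbar T)
  end.

Definition mu (T : R -> Prop) (t : R) : R := sigma T t - t.

Definition left_scattered (T : R -> Prop) (t : R) : Prop := rho T t < t.

Definition is_maximum (T : R -> Prop) (t : R) : Prop :=
  T t /\ forall s, T s -> s <= t.

Definition kappa (T : R -> Prop) (t : R) : Prop :=
  T t /\ ~ (is_maximum T t /\ left_scattered T t).

(** [l] is the delta derivative of [f] at [t]. *)
Definition is_delta_derive (T : R -> Prop) (f : R -> C) (t : R) (l : C) : Prop :=
  forall eps : R, 0 < eps ->
  exists delta : R, 0 < delta /\
    forall s : R, T s -> Rabs (s - t) < delta ->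
      Cmod (f (sigma T t) - f s - l * (sigma T t - s)%R)%C
        <= eps * Rabs (sigma T t - s).

(** [f] is delta differentiable (at every point of [kappa T]) and [fD] is its
    delta derivative.  The derivative is unique except at the point of a
    one-point time scale, where every number is one; there [fD] is any choice. *)
Definition is_delta_derivative (T : R -> Prop) (f fD : R -> C) : Prop :=
  forall t : R, kappa T t -> is_delta_derive T f t (fD t).

Definition circle_plus (T : R -> Prop) (a b : R -> C) (t : R) : C :=
  (a t + b t + mu T t * a t * b t)%C.

(** * Multi-valued functions, as sets of complex values *)

(** e^(x + iy) = e^x (cos y + i sin y) *)
Definition Cexp (z : C) : C :=
  (exp (Re z) * cos (Im z), exp (Re z) * sin (Im z)).

Definition Clog (w : C) : C -> Prop := fun l => Cexp l = w.

(** For [h > 0] and [z = -1/h], where the transformation is not defined, this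
    is the empty set. *)
Definition zeta (h : R) (z : C) : C -> Prop :=
  fun w =>
    if Req_EM_T h 0 then w = z
    else exists l : C, Clog (1 + z * h)%C l /\ w = (/ h * l)%C.

Definition set_plus (A B : C -> Prop) : C -> Prop :=
  fun w => exists a b : C, A a /\ B b /\ w = (a + b)%C.

Definition set_eq (A B : C -> Prop) : Prop := forall w : C, A w <-> B w.

(* Main.v *)
(** At a point [t] of the time scale the delta derivative satisfies
    [f (sigma t) = f t + mu t * fD t], so [1 + mu t * (fD t / f t)] is the quotient
    [f (sigma t) / f t], which is nonzero because [sigma t] lies in the time scale.
    Since [1 + (a (+) b) h = (1 + a h) (1 + b h)], the claim reduces to
    [log (u v) = log u + log v] for multi-valued logarithms. For the inclusion from
    left to right, [u <> 0] supplies one logarithm of [u], and subtracting it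
    from a logarithm of [u v] leaves a logarithm of [v]. *)
Require Import Defs.
From Stdlib Require Import Reals Lra.
From Coquelicot Require Import Coquelicot.

Open Scope R_scope.

Lemma Cexp_plus (x y : C) : Cexp (x + y)%C = (Cexp x * Cexp y)%C.
Proof.
destruct x as [a b], y as [c d].
unfold Cexp, Cplus, Cmult, Re, Im; simpl.
rewrite exp_plus, cos_plus, sin_plus.
f_equal; ring.
Qed.

(** The angle is [acos x] up to sign: its sine is [sqrt (1 - x²)], which equals [Rabs y], so the
    angle is negated when [y] is negative. *)
Lemma unit_circle_param (x y : R) :
  x * x + y * y = 1 -> exists t : R, cos t = x /\ sin t = y.
Proof.
intros H.
assert (Hx : -1 <= x <= 1) by nra.
assert (Hs : sqrt (1 - x²) = Rabs y).
{ rewrite <- sqrt_Rsqr_abs; f_equal; unfold Rsqr; lra. }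
destruct (Rle_dec 0 y) as [Hy|Hy].
- exists (acos x); rewrite cos_acos, sin_acos, Hs by exact Hx.
  split; [reflexivity | apply Rabs_pos_eq; exact Hy].
- exists (- acos x); rewrite cos_neg, sin_neg, cos_acos, sin_acos, Hs by exact Hx.
  split; [reflexivity | rewrite Rabs_left; lra].
Qed.

(** Polar form: the real part is [ln (Cmod w)] and the imaginary part an angle of the unit vector
    [w / Cmod w]. *)
Lemma Clog_exists (w : C) : w <> RtoC 0 -> exists l : C, Clog w l.
Proof.
intros Hw.
pose proof (proj1 (Cmod_gt_0 w) Hw) as Hr.
assert (Hsq : Cmod w * Cmod w = fst w * fst w + snd w * snd w).
{ unfold Cmod; rewrite sqrt_sqrt; nra. }
destruct (unit_circle_param (fst w / Cmod w) (snd w / Cmod w)) as [t [Hc Hs]].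
{ transitivity ((fst w * fst w + snd w * snd w) / (Cmod w * Cmod w)).
  - field; lra.
  - rewrite <- Hsq; field; lra. }
exists (ln (Cmod w), t); unfold Clog, Cexp, Re, Im; simpl.
rewrite Hc, Hs, exp_ln by exact Hr.
transitivity (fst w, snd w); [|symmetry; apply surjective_pairing].
f_equal; field; lra.
Qed.

Lemma Clog_mult (u v : C) :
  u <> RtoC 0 -> set_eq (Clog (u * v)%C) (set_plus (Clog u) (Clog v)).
Proof.
intros Hu w; split.
- intros Hw.
  destruct (Clog_exists u Hu) as [a Ha].
  exists a, (w - a)%C; repeat split; [exact Ha | | ring].
  unfold Clog in *.
  assert (H : (u * Cexp (w - a))%C = (u * v)%C).
  { rewrite <- Hw, <- Ha, <- Cexp_plus; f_equal; ring. }
  transitivity (/ u * (u * Cexp (w - a)))%C; [field; exact Hu|].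
  rewrite H; field; exact Hu.
- intros [a [b [Ha [Hb ->]]]]; unfold Clog in *.
  rewrite Cexp_plus, Ha, Hb; reflexivity.
Qed.

(** If a ball of radius [eps] around [m] missed [T], then [m + eps] would be a lower bound of [P]
    larger than [m]. *)
Lemma closed_glb (T : R -> Prop) (P : R -> Prop) (m : R) :
  closed T -> (forall x, P x -> T x) -> is_glb_Rbar P m -> T m.
Proof.
intros HT HP [Hlb Hglb]; apply HT; intros [eps Heps].
assert (Hle : Rbar_le (m + eps) m).
{ apply Hglb; intros x Hx; simpl.
  destruct (Rle_dec (m + eps) x) as [h|h]; [exact h|exfalso].
  apply (Heps x); [|apply HP, Hx].
  pose proof (Hlb x Hx) as Hmx; simpl in Hmx.
  unfold ball; simpl; unfold AbsRing_ball, abs, minus, plus, opp; simpl.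
  rewrite Rabs_pos_eq; lra. }
simpl in Hle; pose proof (cond_pos eps); lra.
Qed.

(* Unqualified, [sigma] would be the finite sum of Stdlib's Reals. *)
Lemma sigma_in (T : R -> Prop) (t : R) : closed T -> T t -> T (Defs.sigma T t).
Proof.
intros HT Ht; unfold Defs.sigma.
pose proof (Glb_Rbar_correct (fun s => T s /\ t < s)) as HG.
destruct (Glb_Rbar _) as [m| |].
- apply (closed_glb T _ m HT) with (2 := HG); tauto.
(* An infimum [p_infty] means that no point of [T] lies above [t]; [sigma] then falls back to the
   supremum of [T], which is [t] itself. *)
- assert (Hmax : forall s, T s -> s <= t).
  { intros s Hs; destruct (Rle_dec s t) as [h|h]; [exact h|].
    exfalso; exact (proj1 HG s (conj Hs (Rnot_le_lt _ _ h))). }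
  replace (Lub_Rbar T) with (Finite t); [exact Ht|].
  symmetry; apply is_lub_Rbar_unique; split.
  + intros s Hs; exact (Hmax s Hs).
  + intros b Hb; exact (Hb t Ht).
- exfalso; apply (proj2 HG t).
  intros s [_ Hs]; simpl; lra.
Qed.

(** Taking [s = t] in the definition bounds the defect [d] by [eps * Rabs (mu T t)] for every
    positive [eps], so [d] vanishes. *)
Lemma delta_derive_sigma (T : R -> Prop) (f : R -> C) (t : R) (l : C) :
  T t -> is_delta_derive T f t l -> f (Defs.sigma T t) = (f t + l * mu T t)%C.
Proof.
intros Ht H.
set (d := (f (Defs.sigma T t) - f t - l * (mu T t))%C).
assert (Hd : forall eps, 0 < eps -> Cmod d <= eps * Rabs (mu T t)).
{ intros eps He; destruct (H eps He) as [delta [Hdelta Hs]].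
  apply Hs; [exact Ht|].
  rewrite Rminus_diag, Rabs_R0; exact Hdelta. }
assert (Hd0 : d = RtoC 0).
{ apply Cmod_eq_0, Rle_antisym; [|apply Cmod_ge_0].
  apply le_epsilon; intros eps He.
  pose proof (Rabs_pos (mu T t)) as Hm.
  (* The summand 1 keeps the denominator positive when the graininess is zero. *)
  assert (Hp : 0 < eps / (1 + Rabs (mu T t))) by (apply Rdiv_lt_0_compat; lra).
  apply Rle_trans with (1 := Hd _ Hp).
  replace (0 + eps) with (eps / (1 + Rabs (mu T t)) * (1 + Rabs (mu T t)))
    by (field; lra).
  apply Rmult_le_compat_l; lra. }
transitivity (d + (f t + l * mu T t))%C; [unfold d; ring|].
rewrite Hd0; ring.
Qed.

Lemma delta_derive_regressive (T : R -> Prop) (f : R -> C) (t : R) (l : C) :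
  closed T -> (forall s, T s -> f s <> RtoC 0) -> T t -> is_delta_derive T f t l ->
  (1 + l / f t * mu T t)%C <> RtoC 0.
Proof.
intros HT Hf Ht Hl H0.
apply (Hf _ (sigma_in T t HT Ht)).
rewrite (delta_derive_sigma T f t l Ht Hl).
transitivity (f t * (1 + l / f t * mu T t))%C; [field; exact (Hf t Ht)|].
rewrite H0; ring.
Qed.

(** For [h = 0] both sides are the single value [a + b]. Otherwise the product rule for logarithms
    carries over, since multiplication by [/ h] distributes over sums of values. *)
Lemma zeta_circle_plus (h : R) (a b : C) :
  (1 + a * h)%C <> RtoC 0 ->
  set_eq (zeta h (a + b + h * a * b)%C) (set_plus (zeta h a) (zeta h b)).
Proof.
intros Ha w; unfold zeta, set_plus.
destruct (Req_EM_T h 0) as [->|Hh].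
- split.
  + intros ->; exists a, b; repeat split; ring.
  + intros [x [y [-> [-> ->]]]]; ring.
- replace (1 + (a + b + h * a * b) * h)%C with ((1 + a * h) * (1 + b * h))%C by ring.
  split.
  + intros [l [Hl ->]].
    apply Clog_mult in Hl; [|exact Ha].
    destruct Hl as [x [y [Hx [Hy ->]]]].
    exists (/ h * x)%C, (/ h * y)%C; repeat split; [eauto | eauto | ring].
  + intros [x [y [[l [Hl ->]] [[k [Hk ->]] ->]]]].
    exists (l + k)%C; split; [|ring].
    apply Clog_mult; [exact Ha|].
    exists l, k; auto.
Qed.

Theorem lemma2p5
  (T : R -> Prop) (HT : time_scale T)
  (f g fD gD : R -> C)
  (HfD : is_delta_derivative T f fD)
  (HgD : is_delta_derivative T g gD)
  (Hf : forall t : R, T t -> f t <> RtoC 0)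
  (Hg : forall t : R, T t -> g t <> RtoC 0)
  (tau : R) (Htau : kappa T tau) :
  set_eq
    (zeta (mu T tau)
       (circle_plus T (fun t => fD t / f t)%C (fun t => gD t / g t)%C tau))
    (set_plus
       (zeta (mu T tau) (fD tau / f tau)%C)
       (zeta (mu T tau) (gD tau / g tau)%C)).
Proof.
apply zeta_circle_plus, delta_derive_regressive.
- exact (proj2 HT).
- exact Hf.
- exact (proj1 Htau).
- exact (HfD tau Htau).
Qed.
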